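(* For every integer $k \geq 3$ there is a number $c(k)$, depending only on $k$, with $$c(k) \leq \frac{k^3+5k+3}{24},$$ such that for every integer $n \geq \frac{(k-1)(k+2)}{2}$, $$t(n,k) - c(k) \leq g(n,k) \leq f(n,k) \leq t(n,k).$$
   Context: Graphs are finite and simple. A path $P = v_1 v_2 \ldots v_m$ (distinct vertices, consecutive ones adjacent) in a graph $G$ is a degree monotone path of length $m$ if $\deg(v_1) \leq \ldots \leq \deg(v_m)$ or $\deg(v_1) \geq \ldots \geq \deg(v_m)$, where degrees are taken in $G$; thus the length of a path is its number of vertices. $mp(G)$ denotes the maximum length of a degree monotone path in $G$. Define $f(n,k) = \max\{|E(G)| : |V(G)| = n,\ mp(G) < k\}$ and the Turán number $t(n,k) = \max\{|E(G)| : |V(G)| = n,\ G \text{ contains no copy of } K_k\}$. Let $A_{n,k}$ be the family of integer sequences $1 \leq a_1 < a_2 < \ldots < a_{k-1}$ with $\sum_{i=1}^{k-1} a_i = n$, and let $g(n,k) = \max \sum_{1 \leq i < j \leq k-1} a_i a_j$, the maximum being over all sequences in $A_{n,k}$. *)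

(* Defs.v *)
From HB Require Import structures.
From mathcomp Require Import all_boot all_order all_algebra.

Set Implicit Arguments.
Unset Strict Implicit.
Unset Printing Implicit Defensive.

Section Graphs.

Variable T : finType.

(* A finite simple graph on the vertex type [T] is given by its edge set. *)
Definition simple_graph (E : {set {set T}}) : bool :=
  [forall e in E, #|e| == 2].

Variable E : {set {set T}}.

(* On a simple graph, [adj x x] is false since [[set x; x]] is a singleton. *)
Definition adj : rel T := fun x y => [set x; y] \in E.

Definition deg (x : T) : nat := #|[set y | adj x y]|.

Definition degree_monotone_path (p : seq T) : bool :=
  [&& uniq p, sorted adj p &
      sorted leq (map deg p) || sorted geq (map deg p)].

(* The vertices of a path are distinct, so no path has more than [#|T|]. *)
Definition mp : nat :=
  \max_(m < #|T|.+1 | [exists p : m.-tuple T, degree_monotone_path p]) m.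

Definition has_clique (k : nat) : bool :=
  [exists K : {set T},
     (#|K| == k) && [forall x in K, forall y in K, (x != y) ==> adj x y]].

End Graphs.

(* The maximum of an empty family is 0 by convention.  This never occurs for
   [f] and [t] when [1 < k] (consider the edgeless graph), nor for [g] when
   [0 < k] and [k * (k - 1) <= 2 * n]. *)
Definition f (n k : nat) : nat :=
  \max_(E : {set {set 'I_n}} | simple_graph E && (mp E < k)) #|E|.

Definition t (n k : nat) : nat :=
  \max_(E : {set {set 'I_n}} | simple_graph E && ~~ has_clique E k) #|E|.

(* The sequence a_1, ..., a_(k-1) is indexed from 0; positive terms summing to
   [n] are at most [n], so taking values in ['I_n.+1] loses nothing. *)
Definition A (n k : nat) : {set {ffun 'I_(k - 1) -> 'I_n.+1}} :=
  [set a : {ffun 'I_(k - 1) -> 'I_n.+1} |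
    [&& [forall i, 1 <= a i],
        [forall i : 'I_(k - 1), forall j : 'I_(k - 1), (i < j) ==> (a i < a j)]
      & \sum_(i < k - 1) a i == n]].

Definition g (n k : nat) : nat :=
  \max_(a in A n k) \sum_(i < k - 1) \sum_(j < k - 1 | i < j) a i * a j.

(* Main.v *)
Require Import Defs.
From mathcomp Require Import all_boot all_order all_algebra.
From mathcomp Require Import zify ring lra.

(** Write [r = k - 1].

    The bound [f <= t] holds because sorting the vertices of a clique by degree
    gives a degree monotone path through all of them ([clique_mp]), so a graph
    without long degree monotone paths has no large clique.

    The bound [g <= f] comes from complete [r]-partite graphs whose parts have
    pairwise distinct sizes [a_1 < ... < a_r].  The degree of a vertex then
    determines its part, and adjacent vertices lie in different parts, so the
    degrees along a degree monotone path are strictly monotone: the path meets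
    each part at most once and has at most [r] vertices ([mp_multipartite]).  By
    the handshake lemma this graph has as many edges as the sum of the
    products [a_i a_j] over [i < j].

    For [t - c <= g], that sum is [(n^2 - \sum a_i^2) / 2] ([sqr_sum]), while
    Turan's theorem in its density form gives [t <= (n^2 - n^2 / r) / 2]
    ([t_le_turan]).  So [t - g] is at most half the excess of [\sum a_i^2] over
    [n^2 / r], that is, half the sum of the squared deviations of the [a_i] from
    their mean.  Distinct integers are least spread out when they are nearly
    consecutive, and every large [n] is the sum of [r + 1] consecutive positive
    integers with one of them left out ([gap_seq]).  The excess is then at most
    that of [r + 1] consecutive integers, [r (r + 1) (r + 2) / 12], whence
    [t - g <= (k - 1) k (k + 1) / 24] ([t_le_g]).  This constant [(k^3 - k) / 24]
    lies below [(k^3 + 5 k + 3) / 24]. *)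

Import Order.TTheory GRing.Theory Num.Theory.

(** * Counting edges by degrees *)

Lemma adj_sym {T : finType} (E : {set {set T}}) : symmetric (adj E).
Proof. by move=> x y; rewrite /adj setUC. Qed.

Lemma adj_irr {T : finType} {E : {set {set T}}} :
  simple_graph E -> irreflexive (adj E).
Proof.
move=> /forall_inP simE x; apply/negP => /simE.
by rewrite setUid cards1.
Qed.

(** Both sides count the pairs of an edge and one of its endpoints; the edges
    at [x] correspond to the neighbours [y] of [x] through [y |-> {x, y}]. *)
Lemma handshake {T : finType} {E : {set {set T}}} :
  simple_graph E -> \sum_x deg E x = 2 * #|E|.
Proof.
move=> simE; have irr := adj_irr simE; move/forall_inP: simE => simE.
have degE x : deg E x = \sum_(e in E) (x \in e).
  rewrite -big_mkcondr sum1_card /deg.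
  have inj : {in [set y | adj E x y] &, injective (fun y => [set x; y])}.
    move=> y z; rewrite !inE => xy xz /setP/(_ y).
    rewrite !inE eqxx orbT => /esym/orP[] /eqP // yx.
    by move: xy; rewrite yx irr.
  rewrite -(card_in_imset inj); apply: eq_card => e.
  rewrite [RHS]inE; apply/imsetP/andP => [[y] | [Ee xe]].
    by rewrite inE => xy ->; rewrite set21.
  have /cards2P[u [v [uv e_uv]]] := simE _ Ee.
  move: xe; rewrite e_uv !inE => /orP[] /eqP xE; subst x.
    by exists v; rewrite // inE /adj -e_uv.
  by exists u; rewrite ?inE 1?adj_sym /adj -?e_uv // setUC.
rewrite (eq_bigr _ (fun x _ => degE x)) exchange_big /= mulnC -sum_nat_const.
apply: eq_bigr => e Ee; rewrite -(eqP (simE _ Ee)) -sum1_card.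
by rewrite [RHS]big_mkcond.
Qed.

(** * Turan's bound *)

Definition is_clique {T : finType} (e : rel T) (K : {set T}) : Prop :=
  {in K &, forall x y, x != y -> e x y}.

(** Turan's theorem for the subgraph induced on [A], with the degree sum in
    place of twice the number of edges.  The induction is on the clique size: if
    [v] has maximum degree in [A], its neighbourhood [N] has no clique with one
    vertex fewer, since [v] would extend it.  Each edge that leaves or avoids
    [N] has an endpoint in [A :\: N], where degrees are at most [#|N|].  Hence
    the degree sum over [A] exceeds that over [N] by at most
    [2 * #|A :\: N| * #|N|]. *)
Lemma turan_weak {T : finType} {e : rel T} (s : nat) (A : {set T}) :
    symmetric e -> irreflexive e ->
    (forall K : {set T}, K \subset A -> is_clique e K -> #|K| != s.+2) ->
  s.+1 * (\sum_(x in A) #|[set y in A | e x y]|) <= s * #|A| ^ 2.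
Proof.
move=> sym irr; elim: s A => [|s IHs] A free.
  rewrite mul1n mul0n leqn0 sum_nat_eq0; apply/forall_inP => x Ax.
  rewrite cards_eq0; apply/eqP/setP => y; rewrite !inE.
  apply/negP => /andP[Ay xy].
  have xNy : x != y by apply: contraTneq xy => ->; rewrite irr.
  have := free [set x; y]; rewrite cards2 xNy => /(_ _ _)/eqP; apply=> //.
    by apply/subsetP => z; rewrite !inE => /orP[] /eqP ->.
  by move=> u v; rewrite !inE => /orP[] /eqP -> /orP[] /eqP ->;
     rewrite ?eqxx // sym.
have [->|[v0 Av0]] := set_0Vmem A; first by rewrite big_set0 muln0.
pose d x := #|[set y in A | e x y]|.
case: (@arg_maxnP _ v0 (mem A) d Av0) => v Av dmax {v0 Av0}.
have {}Av : v \in A := Av.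
pose N := [set y in A | e v y].
have sNA : N \subset A by apply/subsetP => y; rewrite inE => /andP[].
have /IHs : forall K : {set T}, K \subset N -> is_clique e K -> #|K| != s.+2.
  move=> K sKN clK; have vK : v \notin K.
    by apply/negP => /(subsetP sKN); rewrite inE irr andbF.
  have := free (v |: K); rewrite cardsU1 vK add1n eqSS; apply.
    by rewrite subUset sub1set Av (subset_trans sKN).
  have vE y : y \in K -> e v y by move=> /(subsetP sKN); rewrite inE => /andP[].
  move=> x y; rewrite !inE => /orP[/eqP ->|Kx] /orP[/eqP ->|Ky].
  - by rewrite eqxx.
  - by move=> _; apply: vE.
  - by move=> _; rewrite sym; apply: vE.
  - exact: clK.
set SN := \sum_(x in N) _ => IHN.
pose M := A :\: N.
have splitA F : \sum_(x in A) F x = \sum_(x in N) F x + \sum_(x in M) F x.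
  by rewrite (big_setID N) /= (setIidPr sNA).
have dM : \sum_(x in M) d x <= #|M| * #|N|.
  rewrite -sum_nat_const; apply: leq_sum => x; rewrite inE => /andP[_ Ax].
  exact: dmax.
have degE (B : {set T}) x : #|[set y in B | e x y]| = \sum_(y in B) e x y.
  by rewrite -sum1_card -big_mkcondr; apply: eq_bigl => y; rewrite inE.
have dE x : d x = #|[set y in N | e x y]| + #|[set y in M | e x y]|.
  by rewrite /d !degE splitA.
(* Of the degrees over N, the part due to edges between N and M is also counted
   by the degrees over M. *)
have dN : \sum_(x in N) d x <= SN + \sum_(x in M) d x.
  rewrite (eq_bigr _ (fun x _ => dE x)) big_split /= leq_add2l.
  under eq_bigr => x _ do rewrite degE.
  rewrite exchange_big /=; apply: leq_sum => x _.
  rewrite dE !degE (eq_bigr (fun y => e x y : nat)) ?leq_addr //.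
  by move=> y _; rewrite sym.
have cA : #|A| = #|N| + #|M| by rewrite -(cardsID N A) (setIidPr sNA).
have Sle : \sum_(x in A) d x <= SN + 2 * (#|M| * #|N|).
  by rewrite splitA; lia.
rewrite cA; move: IHN Sle {dN dM dE}; rewrite -/d.
move: SN #|N| #|M| (\sum_(x in A) d x) => a b c S h1 h2.
have h3 : s.+1 * (s.+2 * S) <= s.+1 * (s.+1 * (b + c) ^ 2).
  have h4 : s.+1 * (s.+2 * S) <= s.+1 * (s.+2 * (a + 2 * (c * b))).
    by rewrite !leq_mul2l h2 !orbT.
  have h5 : s.+2 * (s.+1 * a) <= s.+2 * (s * b ^ 2) by rewrite leq_mul2l h1.
  (* What remains after h4 and h5 is that the square of s.+1 * c - b is
     nonnegative. *)
  have h6 : (2 * (s.+1 * c) * b <= (s.+1 * c) ^ 2 + b ^ 2).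
    by rewrite -mulnA; apply: (nat_Cauchy (s.+1 * c) b).1.
  by lia.
by move: h3; rewrite leq_pmul2l.
Qed.

Lemma t_le_turan {k : nat} (n : nat) :
  1 < k -> 2 * (k - 1) * t n k <= (k - 2) * n ^ 2.
Proof.
case: k => [|[|s]] // _; rewrite subn1 subn2 /=.
pose P m := 2 * s.+1 * m <= s * n ^ 2.
rewrite -/(P _) /t; elim/big_ind: _ => [|x y Px Py|E /andP[simE noK]].
- by rewrite /P muln0.
- by rewrite /P; case: (leqP x y).
have := turan_weak s [set: 'I_n] (adj_sym _) (adj_irr simE).
rewrite cardsT card_ord (eq_bigl predT) => [|x]; last by rewrite inE.
have -> : \sum_x #|[set y in setT | adj E x y]| = 2 * #|E|.
  rewrite -handshake //; apply: eq_bigr => x _; apply: eq_card => y.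
  by rewrite !inE.
rewrite /P mulnA [2 * _]mulnC; apply=> K _ clK.
apply: contraNneq noK => Ksize; apply/existsP; exists K; rewrite Ksize eqxx /=.
apply/forall_inP => x Kx; apply/forall_inP => y Ky; apply/implyP; exact: clK.
Qed.

(** * Cliques and degree monotone paths *)

Lemma leq_size_mp {T : finType} {E : {set {set T}}} {p : seq T} :
  degree_monotone_path E p -> size p <= mp E.
Proof.
move=> pP; have sp : size p < #|T|.+1.
  by case/and3P: pP => /card_uniqP <- _ _; rewrite ltnS max_card.
apply: (leq_bigmax_cond (F := @nat_of_ord _) (Ordinal sp)) => /=.
by apply/existsP; exists (in_tuple p).
Qed.

(** Any ordering of a clique is a path, in particular the one by degree. *)
Lemma clique_mp {T : finType} {E : {set {set T}}} {k : nat} :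
  has_clique E k -> k <= mp E.
Proof.
case/existsP => K /andP[/eqP <- /forall_inP clK].
pose le_deg := relpre (deg E) leq.
have tot : total le_deg by move=> x y; apply: leq_total.
pose p := sort le_deg (enum K).
have -> : #|K| = size p by rewrite size_sort cardE.
have up : uniq p by rewrite sort_uniq enum_uniq.
apply: leq_size_mp; rewrite /degree_monotone_path up /=; apply/andP; split.
  have : pairwise (adj E) p.
    have pK : {subset p <= K} by move=> x; rewrite mem_sort mem_enum.
    move: up pK; elim: p => //= x p IHp /andP[xp up] pK.
    rewrite IHp ?andbT //; last by move=> y yp; apply: pK; rewrite inE yp orbT.
    apply/allP => y yp.
    have /forall_inP/(_ y) := clK x (pK x (mem_head _ _)).
    rewrite pK ?inE ?yp ?orbT // => /(_ isT)/implyP; apply.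
    by apply: contraNneq xp => ->.
  exact: pairwise_sorted.
by rewrite sorted_map sort_sorted.
Qed.

Lemma f_le_t (n k : nat) : f n k <= t n k.
Proof.
apply/bigmax_leqP => E /andP[simE mpE]; apply: leq_bigmax_cond.
by rewrite simE; apply: contraL mpE => /clique_mp; rewrite -leqNgt.
Qed.

(** * Complete multipartite graphs with distinct part sizes *)

Definition multipartite {T C : finType} (c : T -> C) : {set {set T}} :=
  [set [set p.1; p.2] | p : T * T & c p.1 != c p.2].

Lemma adj_multipartite {T C : finType} (c : T -> C) x y :
  adj (multipartite c) x y = (c x != c y).
Proof.
apply/imsetP/idP => [[[u v]]|xy]; last by exists (x, y); rewrite ?inE.
rewrite inE /= => uv /setP e.
apply: contraNneq uv => cxy.
have := e u; have := e v; rewrite !inE !eqxx orbT /=.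
by move=> /orP[] /eqP -> /orP[] /eqP ->; rewrite ?cxy.
Qed.

Lemma multipartite_simple {T C : finType} (c : T -> C) :
  simple_graph (multipartite c).
Proof.
apply/forall_inP => e /imsetP[[x y]]; rewrite inE /= => xy ->.
suff xNy : x != y by rewrite cards2 xNy.
by apply: contraNneq xy => ->.
Qed.

Lemma deg_multipartite {T C : finType} (c : T -> C) x :
  deg (multipartite c) x = #|T| - #|[set y | c y == c x]|.
Proof.
rewrite -(cardsC [set y | c y == c x]) addKn; apply: eq_card => y.
by rewrite !inE adj_multipartite eq_sym.
Qed.

(** Adjacent vertices have different degrees because their parts differ, hence
    so do the sizes of these parts.  A monotone sequence of degrees along a path
    is therefore strictly monotone, so no part is visited twice. *)
Lemma mp_multipartite {T C : finType} (c : T -> C) :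
    injective (fun i => #|[set y | c y == i]|) ->
  mp (multipartite c) <= #|C|.
Proof.
move=> inj; apply/bigmax_leqP => m /existsP[p /and3P[_ adjp mon]].
set G := multipartite c in adjp mon.
pose h i := #|T| - #|[set y | c y == i]|.
have degE : deg G =1 h \o c by move=> x; rewrite /= deg_multipartite.
have degN x y : adj G x y -> deg G x != deg G y.
  rewrite adj_multipartite !degE; apply: contraNneq => /= hxy; apply/eqP/inj.
  have lt i : #|[set y | c y == i]| <= #|T| by apply: max_card.
  by have := lt (c x); have := lt (c y); move: hxy; rewrite /h; lia.
have : uniq (map (deg G) p).
  case/orP: mon => mon.
    apply: (sorted_uniq ltn_trans ltnn); rewrite sorted_map.
    apply: (sub_sorted (e := [rel x y | adj G x y && (deg G x <= deg G y)])).
      by move=> x y /= /andP[/degN]; rewrite ltn_neqAle => -> ->.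
    by rewrite sorted_relI adjp -sorted_map.
  have gtn_trans : transitive gtn by move=> y x z /= yx zy; apply: ltn_trans yx.
  apply: (sorted_uniq gtn_trans ltnn); rewrite sorted_map.
  apply: (sub_sorted (e := [rel x y | adj G x y && (deg G y <= deg G x)])).
    by move=> x y /= /andP[/degN]; rewrite ltn_neqAle eq_sym => -> ->.
  by rewrite sorted_relI adjp; move: mon; rewrite sorted_map.
rewrite (eq_map degE) map_comp => /map_uniq/card_uniqP.
by rewrite size_map size_tuple => <-; apply: max_card.
Qed.

(** A bijection of ['I_n] with the disjoint union of the ['I_(a i)] turns the
    index of a summand into a colour. *)
Lemma exists_coloring {r n : nat} (a : 'I_r -> nat) :
    \sum_i a i = n ->
  exists c : 'I_n -> 'I_r, forall i, #|[set x | c x == i]| = a i.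
Proof.
move=> <-.
have cardT : \sum_i a i = #|{: {i : 'I_r & 'I_(a i)}}|.
  by rewrite card_tagged sumnE big_map big_enum; apply: eq_bigr => i _; rewrite card_ord.
pose h x : {i : 'I_r & 'I_(a i)} := enum_val (cast_ord cardT x).
exists (fun x => tag (h x)) => i.
have hinj : injective h by move=> x y /enum_val_inj/cast_ord_inj.
have tinj : injective (fun y => Tagged (fun i => 'I_(a i)) y : {i : 'I_r & 'I_(a i)}).
  by move=> i' x y /eqP; rewrite eq_Tagged => /eqP.
rewrite -(card_imset _ hinj) -[RHS]card_ord -(card_imset _ (tinj i)).
apply: eq_card => -[j y]; apply/imsetP/imsetP => [[x]|[z _ [ej eyz]]].
  rewrite inE => /eqP ex e; rewrite -e /= in ex.
  by subst j; exists y.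
have hK u : h (cast_ord (esym cardT) (enum_rank u)) = u.
  by rewrite /h cast_ordKV enum_rankK.
by exists (cast_ord (esym cardT) (enum_rank (Tagged (fun i => 'I_(a i)) y))); rewrite ?inE hK //= ej.
Qed.

Lemma sqr_sum {r : nat} (a : 'I_r -> nat) :
  (\sum_i a i) ^ 2
    = 2 * (\sum_(i < r) \sum_(j < r | i < j) a i * a j) + \sum_i a i ^ 2.
Proof.
rewrite -mulnn big_distrlr /=.
transitivity (\sum_(i < r) (\sum_(j < r | i < j) a i * a j
      + \sum_(j < r | j < i) a i * a j + a i ^ 2)).
  apply: eq_bigr => i _; rewrite (bigD1 i) //= addnC -mulnn; congr (_ + _).
  rewrite (bigID (fun j : 'I_r => i < j)) /=; congr (_ + _).
    by apply: eq_bigl => j; rewrite -val_eqE /=; lia.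
  by apply: eq_bigl => j; rewrite -val_eqE /=; lia.
rewrite 2!big_split /=; congr (_ + _); rewrite mul2n -addnn; congr (_ + _).
rewrite (exchange_big_dep predT) //=; apply: eq_bigr => i _.
by apply: eq_bigr => j _; rewrite mulnC.
Qed.

(** The graph whose part sizes are the terms of the sequence has the required
    number of edges: [2 |E| = \sum_i a_i (n - a_i) = n^2 - \sum_i a_i^2]. *)
Lemma g_le_f (n : nat) {k : nat} : 0 < k -> g n k <= f n k.
Proof.
move=> k_gt0; apply/bigmax_leqP => a; rewrite inE => /and3P[_ /forallP incr /eqP sum_a].
have incr' (i j : 'I_(k - 1)) : i < j -> a i < a j by apply/implyP/(forallP (incr i)).
have inj_a : injective (fun i => a i : nat).
  move=> i j aij; apply: val_inj.
  by case: (ltngtP i j) => // /incr'; rewrite aij ltnn.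
have [c cE] := exists_coloring (fun i => a i : nat) sum_a.
pose G := multipartite c.
suff -> : \sum_(i < k - 1) \sum_(j < k - 1 | i < j) a i * a j = #|G|.
  apply: leq_bigmax_cond; rewrite multipartite_simple /=.
  apply: (@leq_ltn_trans #|'I_(k - 1)|); last by rewrite card_ord; lia.
  apply: mp_multipartite => i j.
  by rewrite !cE; apply: inj_a.
have := handshake (multipartite_simple c); rewrite -/G.
have -> : \sum_x deg G x = \sum_i a i * (n - a i).
  rewrite (partition_big c predT) //=; apply: eq_bigr => i _.
  rewrite -[in RHS]cE -sum_nat_const; apply: eq_big => x; first by rewrite inE.
  by move=> /eqP <-; rewrite deg_multipartite cE card_ord.
have := sqr_sum (fun i => a i : nat); rewrite sum_a.
have : \sum_i a i * (n - a i) + \sum_i a i ^ 2 = n ^ 2.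
  have -> : n ^ 2 = \sum_i a i * n by rewrite -big_distrl /= sum_a.
  rewrite -big_split /=; apply: eq_bigr => i _.
  by rewrite -mulnn -mulnDr subnK // -ltnS ltn_ord.
by lia.
Qed.

(** * Distinct summands close to their mean *)

Lemma sum_ord (m : nat) : 2 * (\sum_(i < m.+1) i) = m * m.+1.
Proof.
elim: m => [|m IH]; first by rewrite big_ord_recr big_ord0.
by rewrite big_ord_recr [LHS]mulnDr /= IH; lia.
Qed.

Lemma sum_ord_sqr (m : nat) : 6 * (\sum_(i < m.+1) i ^ 2) = m * m.+1 * (2 * m + 1).
Proof.
elim: m => [|m IH]; first by rewrite big_ord_recr big_ord0.
by rewrite big_ord_recr [LHS]mulnDr /= IH; lia.
Qed.

(** The sequence is [x, ..., x + r] with [x + m] left out.  With [T] the sum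
    [0 + ... + r], its sum is [r x + T - m], so [x] and [m] come from dividing
    [n - T] by [r].  The deviation identity [key] reads
      [12 (r * \sum a_i^2 - n^2) = r^2 (r + 1) (r + 2) - 3 (r + 1) (2 m - r)^2]
    and dropping the last square leaves the bound, with equality when the gap
    is in the middle. *)
Lemma gap_seq {n r : nat} :
    0 < r -> r * r.+1 <= 2 * n ->
  exists2 a : 'I_r -> nat,
    [/\ forall i, 0 < a i, forall i j : 'I_r, i < j -> a i < a j & \sum_i a i = n]
  & 12 * (r * \sum_i a i ^ 2) <= 12 * n ^ 2 + r ^ 2 * (r.+1 * r.+2).
Proof.
move=> r_gt0 n_large.
have T1 := sum_ord r; have T2 := sum_ord_sqr r.
have [x [m [x_gt0 mE]]] : exists (x : nat) (m : 'I_r.+1),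
    0 < x /\ n + m = r * x + \sum_(i < r.+1) i.
  have [D nE] : exists D, n = D + \sum_(i < r.+1) i.
    by exists (n - \sum_(i < r.+1) i); rewrite subnK //; lia.
  (* D is rounded up to the next multiple of r, and m is the amount added, at
     least 1; so x is positive even when D < r. *)
  have m_lt : r - D %% r < r.+1 by rewrite ltnS leq_subr.
  exists (D %/ r).+1, (Ordinal m_lt); split=> //=.
  have := divn_eq D r; have := ltn_pmod D r_gt0.
  rewrite nE addnAC; move: (D %/ r) (D %% r) {m_lt} => q e e_lt DE.
  by congr (_ + _); rewrite DE mulnS mulnC; lia.
pose F i := x + i; exists (fun i : 'I_r => F (lift m i)).
  have sumF : \sum_(i < r.+1) F i = x + m + \sum_(i < r) F (lift m i).
    by rewrite (bigD1_ord m).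
  split=> [i|i j ij|]; first by rewrite addn_gt0 x_gt0.
    by rewrite ltn_add2l /= /bump; case: (leqP m i); case: (leqP m j); lia.
  have : \sum_(i < r.+1) F i = r.+1 * x + \sum_(i < r.+1) i.
    by rewrite big_split /= sum_nat_const card_ord.
  rewrite sumF => sumE; apply: (@addnI (x + m)); rewrite sumE.
  by lia.
have sumF : \sum_(i < r.+1) F i ^ 2 = (x + m) ^ 2 + \sum_(i < r) F (lift m i) ^ 2.
  by rewrite (bigD1_ord m).
have sumE : \sum_(i < r.+1) F i ^ 2
    = r.+1 * x ^ 2 + 2 * x * (\sum_(i < r.+1) i) + \sum_(i < r.+1) i ^ 2.
  under eq_bigr do rewrite sqrnD addnAC.
  rewrite 2!big_split /= sum_nat_const card_ord big_distrr /=.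
  by congr (_ + _ + _); apply: eq_bigr => i _; rewrite mulnA.
move: sumF; rewrite sumE; set S := \sum_(i < r) _ => SE.
move: T1 T2 mE SE; move: (\sum_(i < r.+1) i) (\sum_(i < r.+1) i ^ 2) => T U.
move: S (nat_of_ord m) => S d T1 T2 mE SE.
(* The signed terms of the deviation identity are moved to the side where they
   are added, since subtraction is truncated; d is the position of the gap. *)
have key : 12 * n ^ 2 + r ^ 2 * (r.+1 * r.+2) + 12 * r * d * r.+1
    = 12 * (r * S) + 12 * d ^ 2 * r.+1 + 3 * r ^ 2 * r.+1.
  apply: (@mulrIn rat 1%R (oner_neq0 _)).
  move/(congr1 (fun i => i%:R : rat)%R): T1.
  move/(congr1 (fun i => i%:R : rat)%R): T2.
  move/(congr1 (fun i => i%:R : rat)%R): mE.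
  move/(congr1 (fun i => i%:R : rat)%R): SE.
  rewrite -!(addn1 r.+1) -!(addn1 r) !(natrD, natrM, natrX) => SE mE T2 T1.
  have {}SE : (S%:R = (r%:R + 1) * x%:R ^+ 2 + 2 * x%:R * T%:R + U%:R
     - (x%:R + d%:R) ^+ 2 :> rat)%R by rewrite SE; ring.
  have {}mE : (n%:R = r%:R * x%:R + T%:R - d%:R :> rat)%R by rewrite -mE; ring.
  have {}T1 : (T%:R = r%:R * (r%:R + 1) / 2 :> rat)%R by lra.
  have {}T2 : (U%:R = r%:R * (r%:R + 1) * (2 * r%:R + 1) / 6 :> rat)%R by lra.
  by rewrite SE mE T1 T2; field.
have : r.+1 * (2 * (r * (2 * d))) <= r.+1 * (r ^ 2 + (2 * d) ^ 2).
  by rewrite leq_mul2l (nat_Cauchy r (2 * d)).1 orbT.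
by lia.
Qed.

(** Turan's bound and the sequence with one gap, compared through
    [n^2 = 2 w + \sum a_i^2], where [w] is the value of that sequence in the
    maximum defining [g]. *)
Lemma t_le_g {n k : nat} :
    1 < k -> (k - 1) * k <= 2 * n ->
  24 * t n k <= 24 * g n k + (k - 1) * (k * k.+1).
Proof.
move=> k_gt1 n_large.
have r_gt0 : 0 < k - 1 by rewrite subn_gt0.
have kE : k = (k - 1).+1 by rewrite subn1 prednK // ltnW.
have [|a [a_gt0 incr sum_a] sqr_a] := gap_seq (n := n) r_gt0; rewrite -?kE //.
rewrite -kE in sqr_a.
(* No term exceeds the sum n, so inord does not change it. *)
pose b := [ffun i : 'I_(k - 1) => inord (a i) : 'I_n.+1].
have bE i : b i = a i :> nat.
  by rewrite ffunE inordK // ltnS -sum_a (bigD1 i) //= leq_addr.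
have sum_b : \sum_i b i = n.
  by rewrite -[RHS]sum_a; apply: eq_bigr => i _; rewrite bE.
pose w := \sum_(i < k - 1) \sum_(j < k - 1 | i < j) b i * b j.
have w_le_g : w <= g n k.
  apply: leq_bigmax_cond; rewrite inE sum_b eqxx andbT; apply/andP; split.
    by apply/forallP => i; rewrite bE.
  apply/forallP => i; apply/forallP => j; apply/implyP => ij.
  by rewrite !bE; apply: incr.
have := sqr_sum (fun i => b i : nat).
have -> : \sum_i b i ^ 2 = \sum_i a i ^ 2 by apply: eq_bigr => i _; rewrite bE.
rewrite sum_b -/w => wE; rewrite -(leq_pmul2l r_gt0).
have := t_le_turan n k_gt1; rewrite (_ : k - 2 = k - 1 - 1); last by rewrite -subnDA.
rewrite mulnBl mul1n.
have := leq_mul (leqnn (k - 1)) w_le_g; have := leq_pmull (n ^ 2) r_gt0.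
move: (n ^ 2) (\sum_i a i ^ 2) (t n k) (g n k) wE sqr_a => N Q tk gk -> {kE}.
move: w {w_le_g} => w; set r := k - 1; clearbody r; lia.
Qed.

Local Open Scope ring_scope.

Theorem theorem3p5 (k : nat) (hk : (3 <= k)%N) :
  exists c : rat,
    c <= (k%:R ^+ 3 + 5 * k%:R + 3) / 24 /\
    forall n : nat, ((k - 1) * (k + 2) %/ 2 <= n)%N ->
      [/\ (t n k)%:R - c <= (g n k)%:R,
          (g n k <= f n k)%N
        & (f n k <= t n k)%N].
Proof.
exists (((k - 1) * (k * k.+1))%N%:R / 24); split.
  rewrite ler_pM2r ?invr_gt0 // -!natrM -natrX -!natrD ler_nat.
  by case: k hk => // r _; rewrite subn1; lia.
move=> n n_large; split; [|by apply: g_le_f; lia|exact: f_le_t].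
(* (k - 1) * (k + 2) / 2 exceeds (k - 1) * k / 2, the least possible sum of
   k - 1 distinct positive integers, by k - 1. *)
have /(t_le_g (ltnW hk)) : ((k - 1) * k <= 2 * n)%N.
  have := divn_eq ((k - 1) * (k + 2)) 2.
  by have := ltn_pmod ((k - 1) * (k + 2)) (isT : 0 < 2)%N; lia.
by rewrite -(ler_nat rat) natrD 2!natrM; lra.
Qed.
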